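(* Let $t(v_1,\dots,v_k)$ be a term in the signature of MV-algebras and let $m=\inf_{a_1,\dots,a_k\in[0,1]}t^{[0,1]_{\L}}(a_1,\dots,a_k)$ and $s=\sup_{a_1,\dots,a_k\in[0,1]}t^{[0,1]_{\L}}(a_1,\dots,a_k)$. Then $m$ and $s$ are almost sure values for $[0,1]_{\L}$: there are sentences $\varphi,\psi$ of $\mathcal{L}^{[0,1]_{\L}}$ such that $\lim_{n\to\infty}\mu_n(\varphi\in V)=1$ for every open interval $V$ containing $m$, and $\lim_{n\to\infty}\mu_n(\psi\in W)=1$ for every open interval $W$ containing $s$.
   Context: $[0,1]_{\L}=\langle[0,1],\wedge,\vee,\to,\neg\rangle$ is the standard MV-algebra: $\min$, $\max$, $x\to y=\min(1,1-x+y)$, $\neg x=1-x$; MV-terms are terms in these operations. Formulas of $\mathcal{L}^{[0,1]_{\L}}(\tau)$, for a finite relational vocabulary $\tau$, are built from atomic formulas with these connectives and quantifiers $\forall,\exists$, evaluated in structures $\mathfrak{M}$ (nonempty domain, maps $R^{\mathfrak{M}}\colon M^{\tau(R)}\to[0,1]$) with $\forall$ as infimum and $\exists$ as supremum. For each $R\in\tau$, $p_R$ is a $\sigma$-additive Borel probability measure on $[0,1]$ giving positive measure to every nontrivial interval; structures with domain $[n]=\{1,\dots,n\}$ form the space $\prod_{R\in\tau}[0,1]^{[n]^{\tau(R)}}$ with product measure $\rho_n$, and $\mu_n(\varphi\in S)=\rho_n\{\mathfrak{M}:\|\varphi\|^{\mathfrak{M}}\in S\}$. Intervals are relative to $[0,1]$.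 *)

(* Defs.v *)
From HB Require Import structures.
From mathcomp Require Import all_boot all_order all_algebra.
From mathcomp Require Import all_classical all_reals all_analysis.

Set Implicit Arguments.
Unset Strict Implicit.
Unset Printing Implicit Defensive.

Import Order.TTheory GRing.Theory Num.Theory.
Import numFieldNormedType.Exports.

Local Open Scope classical_set_scope.
Local Open Scope ring_scope.

(* The real unit interval with its Borel sigma-algebra, i.e. the trace of the
   Borel sigma-algebra of R. *)
Definition I01 (R : realType) : Type := {i01 R}.

Definition I01val (R : realType) (x : I01 R) : R := (x : {i01 R})%:num.

HB.instance Definition _ (R : realType) := Choice.on (I01 R).
HB.instance Definition _ (R : realType) :=
  isPointed.Build (I01 R) (0%:i01 : {i01 R}).
HB.instance Definition _ (R : realType) :=
  Measurable.copy (I01 R) (g_sigma_algebra_preimageType (@I01val R)).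

Section mv_operations.
Variable R : realType.
Implicit Types x y : R.

Definition mv_and x y := Num.min x y.
Definition mv_or x y := Num.max x y.
Definition mv_imp x y := Num.min 1 (1 - x + y).
Definition mv_neg x := 1 - x.

End mv_operations.

Inductive mv_term (k : nat) :=
| TVar of 'I_k
| TAnd of mv_term k & mv_term k
| TOr of mv_term k & mv_term k
| TImp of mv_term k & mv_term k
| TNeg of mv_term k.

Fixpoint mv_eval (R : realType) k (a : 'I_k -> I01 R) (t : mv_term k) : R :=
  match t with
  | TVar i => I01val (a i)
  | TAnd t u => mv_and (mv_eval a t) (mv_eval a u)
  | TOr t u => mv_or (mv_eval a t) (mv_eval a u)
  | TImp t u => mv_imp (mv_eval a t) (mv_eval a u)
  | TNeg t => mv_neg (mv_eval a t)
  end.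

Definition mv_inf (R : realType) k (t : mv_term k) : R :=
  inf (range (fun a : 'I_k -> I01 R => mv_eval a t)).

Definition mv_sup (R : realType) k (t : mv_term k) : R :=
  sup (range (fun a : 'I_k -> I01 R => mv_eval a t)).

Record vocabulary := Vocabulary {
  symbol :> finType;
  arity : symbol -> nat
}.

(* formula tau k: formulas whose free variables are among k variables,
   numbered in de Bruijn style: a quantifier binds variable 0 of its body and
   variable i.+1 of the body is variable i outside. *)
Inductive formula (tau : vocabulary) : nat -> Type :=
| Atom k (Q : tau) of (arity Q).-tuple 'I_k : formula tau k
| FAnd k of formula tau k & formula tau k : formula tau k
| FOr k of formula tau k & formula tau k : formula tau k
| FImp k of formula tau k & formula tau k : formula tau k
| FNeg k of formula tau k : formula tau k
| FAll k of formula tau k.+1 : formula tau k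
| FEx k of formula tau k.+1 : formula tau k.

Definition sentence (tau : vocabulary) := formula tau 0.

(* The domain D is an arbitrary type; only the domains 'I_n occur below. *)
Definition structure (R : realType) (tau : vocabulary) (D : Type) :=
  forall Q : tau, (arity Q).-tuple D -> I01 R.

Fixpoint eval (R : realType) (tau : vocabulary) (D : Type)
    (M : structure R tau D) k (f : formula tau k) : k.-tuple D -> R :=
  match f in formula _ k return k.-tuple D -> R with
  | Atom k Q v => fun e => I01val (M Q [tuple of map (tnth e) v])
  | FAnd k f g => fun e => mv_and (eval M f e) (eval M g e)
  | FOr k f g => fun e => mv_or (eval M f e) (eval M g e)
  | FImp k f g => fun e => mv_imp (eval M f e) (eval M g e)
  | FNeg k f => fun e => mv_neg (eval M f e)
  | FAll k f => fun e => inf (range (fun a : D => eval M f [tuple of a :: e]))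
  | FEx k f => fun e => sup (range (fun a : D => eval M f [tuple of a :: e]))
  end.

Definition value (R : realType) (tau : vocabulary) (D : Type)
    (M : structure R tau D) (f : sentence tau) : R := eval M f [tuple].

Section tuple_product.
Context d (T : measurableType d) (R : realType).

Definition cons_pair n (x : T * n.-tuple T) : n.+1.-tuple T :=
  [tuple of x.1 :: x.2].

Lemma measurable_cons_pair n : measurable_fun setT (@cons_pair n).
Proof. exact: measurable_cons. Qed.

HB.instance Definition _ n :=
  isMeasurableFun.Build _ _ _ _ (@cons_pair n) (@measurable_cons_pair n).

(* Product of finitely many probabilities, as the image of iterated binary
   products. *)
Fixpoint tuple_prod n : ('I_n -> probability T R) ->
    probability (n.-tuple T) R :=
  match n with
  | 0 => fun _ => \d_([tuple] : 0.-tuple T)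
  | n.+1 => fun P => distribution
      (P ord0 \x tuple_prod (fun i => P (lift ord0 i)))%E (@cons_pair n)
  end.

End tuple_product.

Section structure_space.
Variables (R : realType) (tau : vocabulary) (D : Type).

HB.instance Definition _ := gen_eqMixin (structure R tau D).
HB.instance Definition _ := gen_choiceMixin (structure R tau D).
HB.instance Definition _ :=
  isPointed.Build (structure R tau D) (fun _ _ => point).

Definition cylinder : set (set (structure R tau D)) :=
  [set A | exists (Q : tau) (a : (arity Q).-tuple D) (B : set (I01 R)),
     measurable B /\ A = [set M | B (M Q a)]].

(* The product sigma-algebra. *)
HB.instance Definition _ :=
  Measurable.copy (structure R tau D) (g_sigma_algebraType cylinder).

End structure_space.

Section random_structure.
Variables (R : realType) (tau : vocabulary) (n : nat).

Definition ground_atom := {Q : tau & (arity Q).-tuple 'I_n}.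

Definition structure_of_tuple (t : #|{: ground_atom}|.-tuple (I01 R)) :
    structure R tau 'I_n :=
  fun Q a => tnth t (enum_rank (Tagged (fun Q => (arity Q).-tuple 'I_n) a)).

Lemma measurable_structure_of_tuple : measurable_fun setT structure_of_tuple.
Proof.
apply: (@measurability _ _ _ _ _ _ (@cylinder R tau 'I_n)) => //.
move=> _ [_ [Q [a [B [mB ->]]]] <-].
exact: (measurable_tnth _ measurableT mB).
Qed.

HB.instance Definition _ := isMeasurableFun.Build _ _ _ _
  structure_of_tuple measurable_structure_of_tuple.

Variable p : tau -> probability (I01 R) R.

(* The product measure on the structures with domain 'I_n; structure_prodE
   below is its characteristic property. *)
Definition structure_prod : probability (structure R tau 'I_n) R :=
  distribution (tuple_prod (fun i : 'I_#|{: ground_atom}| =>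
                              p (tag (enum_val i)))) structure_of_tuple.

Definition mu (f : sentence tau) (S : set R) : \bar R :=
  structure_prod [set M | S (value M f)].

End random_structure.

Lemma tuple_prodE d (T : measurableType d) (R : realType) n
    (P : 'I_n -> probability T R) (A : 'I_n -> set T) :
  (forall i, measurable (A i)) ->
  tuple_prod P [set t | forall i, A i (tnth t i)] =
    (\prod_(i < n) P i (A i))%E.
Proof.
elim: n P A => [|n IH] P A mA.
  rewrite big_ord0 /= diracE mem_set//=.
  by case.
rewrite big_ord_recl -IH; last by move=> i; exact: mA.
rewrite -product_measure1E//=.
- rewrite /distribution/= /pushforward; congr (_ _); apply/seteqP; split=> [] [x t]/=.
    by move=> H; split=> [|i]; [exact: (H ord0)|have := H (lift ord0 i); rewrite tnthS].
  move=> [Ax At] i; case: (unliftP ord0 i) => [j|] ->//.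
  by rewrite /cons_pair tnthS.
- rewrite (_ : mkset _ = \big[setI/setT]_(i < n) (fun t => A (lift ord0 i) (tnth t i))).
    apply: bigsetI_measurable => i _; rewrite -[X in measurable X]setTI.
    exact: measurable_tnth.
  rewrite -bigcap_seq; apply/seteqP; split=> t /= H i; first by move=> _; exact: H.
  by apply: H; rewrite /= mem_index_enum.
Qed.

Lemma structure_prodE (R : realType) (tau : vocabulary) n
    (p : tau -> probability (I01 R) R)
    (A : forall Q : tau, (arity Q).-tuple 'I_n -> set (I01 R)) :
  (forall Q a, measurable (A Q a)) ->
  structure_prod n p [set M | forall Q a, A Q a (M Q a)] =
    (\prod_(Q : tau) \prod_(a : (arity Q).-tuple 'I_n) p Q (A Q a))%E.
Proof.
move=> mA.
pose B (x : ground_atom tau n) := A (tag x) (tagged x).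
transitivity (\prod_(x : ground_atom tau n) p (tag x) (B x))%E.
  rewrite (reindex (@enum_val _ (@predT (ground_atom tau n)))) /=; last first.
    exists enum_rank => x _; [exact: enum_valK|exact: enum_rankK].
  rewrite -tuple_prodE; last by move=> i; exact: mA.
  rewrite /structure_prod /distribution /= /pushforward; congr (_ _).
  apply/seteqP; split=> t /= H.
    move=> i; have := H (tag (enum_val i)) (tagged (enum_val i)).
    by rewrite /structure_of_tuple taggedK enum_valK.
  move=> Q a; have := H (enum_rank (Tagged (fun Q => (arity Q).-tuple 'I_n) a)).
  by rewrite /B enum_rankK.
by rewrite sig_big_dep.
Qed.

Definition charges_intervals (R : realType) (p : probability (I01 R) R) :=
  forall V : set R, V `<=` `[0, 1] -> is_interval V ->
    (exists x y, [/\ V x, V y & x < y]) ->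
    (0 < p (@I01val R @^-1` V))%E.

(* Openness is relative to [0, 1]: [0, b[ and ]a, 1] are allowed. *)
Definition open_interval01 (R : realType) (V : set R) :=
  is_interval V /\ exists2 U : set R, open U & V = `[0, 1] `&` U.

(* The value of mu at n = 0 (empty domain) does not affect the limit. *)
Definition almost_sure_value (R : realType) (tau : vocabulary)
    (p : tau -> probability (I01 R) R) (a : R) :=
  exists f : sentence tau, forall V : set R,
    open_interval01 V -> V a -> mu n p f V @[n --> \oo] --> 1%E.

(* Main.v *)
Require Import Defs.
From HB Require Import structures.
From mathcomp Require Import all_boot all_order all_algebra.
From mathcomp Require Import all_classical all_reals all_analysis.
From mathcomp Require Import measurable_realfun lra.

(** Let Q be a symbol of positive arity. The sentence
   psi = exists x_1 ... x_k, t(Q(x_1, ..., x_1), ..., Q(x_k, ..., x_k)) never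
   exceeds s = sup t. Pick a point a where t is close to s: by Lipschitz
   continuity of t, psi is close to s as soon as every a_i is approximated by
   some diagonal value Q(x, ..., x). These n values are independent, and each
   has a fixed positive probability of being near a_i, so this fails with a
   probability that decays geometrically in n. The infimum is obtained from
   inf t = 1 - sup (neg t). *)

Set Implicit Arguments.
Unset Strict Implicit.
Unset Printing Implicit Defensive.

Import Order.TTheory GRing.Theory Num.Theory.
Import numFieldNormedType.Exports.

Local Open Scope classical_set_scope.
Local Open Scope ring_scope.

(** * MV-terms as bounded Lipschitz functions *)

Section mv_term_theory.
Variable R : realType.

Lemma I01val_itv (x : I01 R) : 0 <= I01val x <= 1.
Proof. by rewrite /I01val ge0 le1. Qed.

Lemma mv_eval_itv k (t : mv_term k) (a : 'I_k -> I01 R) : 0 <= mv_eval a t <= 1.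
Proof.
elim: t => [i|t IHt u IHu|t IHt u IHu|t IHt u IHu|t IHt] /=.
- exact: I01val_itv.
- by rewrite /mv_and; case: (leP (mv_eval a t)) => ?; lra.
- by rewrite /mv_or; case: (leP (mv_eval a t)) => ?; lra.
- by rewrite /mv_imp; case: (leP 1 (1 - _ + _)) => ?; lra.
- by rewrite /mv_neg; lra.
Qed.

(** Induction on the term: negation keeps the constant, and for each binary connective the constants
    of the two arguments add up, as [step] checks for all three at once. Strict positivity of [C]
    allows dividing by it when a radius is chosen later. *)
Lemma mv_eval_lipschitz k (t : mv_term k) : exists2 C : R, 0 < C &
  forall (a b : 'I_k -> I01 R) d,
    (forall i, `|I01val (a i) - I01val (b i)| <= d) ->
    `|mv_eval a t - mv_eval b t| <= C * d.
Proof.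
have step C D d x y x' y' : `|x - x'| <= C * d -> `|y - y'| <= D * d ->
  [/\ `|mv_and x y - mv_and x' y'| <= (C + D) * d :> R,
      `|mv_or x y - mv_or x' y'| <= (C + D) * d &
      `|mv_imp x y - mv_imp x' y'| <= (C + D) * d].
  rewrite !ler_norml /mv_and /mv_or /mv_imp => Hx Hy.
  split; [case: (leP x y); case: (leP x' y')|case: (leP x y); case: (leP x' y')
         |case: (leP 1 (1 - x + y)); case: (leP 1 (1 - x' + y'))] => ? ?; lra.
elim: t => [i|t [C C0 IHt] u [D D0 IHu]|t [C C0 IHt] u [D D0 IHu]
           |t [C C0 IHt] u [D D0 IHu]|t [C C0 IHt]] /=.
- by exists 1 => // a b d abd; rewrite mul1r.
- exists (C + D) => [|a b d abd]; first exact: addr_gt0.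
  by case: (step C D d _ _ _ _ (IHt _ _ _ abd) (IHu _ _ _ abd)).
- exists (C + D) => [|a b d abd]; first exact: addr_gt0.
  by case: (step C D d _ _ _ _ (IHt _ _ _ abd) (IHu _ _ _ abd)).
- exists (C + D) => [|a b d abd]; first exact: addr_gt0.
  by case: (step C D d _ _ _ _ (IHt _ _ _ abd) (IHu _ _ _ abd)).
- exists C => // a b d abd; have := IHt _ _ _ abd.
  by rewrite /mv_neg !ler_norml; lra.
Qed.

Lemma has_sup_mv_eval k (t : mv_term k) :
  has_sup (range (fun a : 'I_k -> I01 R => mv_eval a t)).
Proof.
split; first by exists (mv_eval (fun=> point) t); exists (fun=> point).
by exists 1 => _ [a _ <-]; case/andP: (mv_eval_itv t a).
Qed.

Lemma mv_eval_le_sup k (t : mv_term k) (a : 'I_k -> I01 R) :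
  mv_eval a t <= mv_sup R t.
Proof. by apply: ub_le_sup; [case: (has_sup_mv_eval t)|exists a]. Qed.

Lemma mv_inf_neg k (t : mv_term k) : mv_inf R t = 1 - mv_sup R (TNeg t).
Proof.
have lb : has_lbound (range (fun a : 'I_k -> I01 R => mv_eval a t)).
  by exists 0 => _ [a _ <-]; case/andP: (mv_eval_itv t a).
apply/le_anti/andP; split.
  rewrite lerBrDr addrC -lerBrDr; apply: ge_sup.
    by case: (has_sup_mv_eval (TNeg t)).
  by move=> _ [a _ <-] /=; rewrite lerD2l lerN2; apply: ge_inf => //; exists a.
apply: lb_le_inf; first by case: (has_sup_mv_eval t).
move=> _ [a _ <-]; have := mv_eval_le_sup (TNeg t) a.
by rewrite /= /mv_neg; lra.
Qed.

End mv_term_theory.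

(** * Suprema over finite nonempty domains, which are maxima *)

Lemma sup_range_bigmax (R : realType) n (g : 'I_n.+1 -> R) :
  sup (range g) = \big[Num.max/g ord0]_i g i.
Proof.
apply/le_anti/andP; split.
  apply: ge_sup; first by exists (g ord0); exists ord0.
  by move=> _ [i _ <-]; exact: le_bigmax.
apply: bigmax_le => [|i _]; (apply: ub_le_sup; last by eexists);
  by exists (\big[Num.max/g ord0]_i g i) => _ [j _ <-]; exact: le_bigmax.
Qed.

Lemma sup_range_attained (R : realType) n (g : 'I_n.+1 -> R) :
  exists i, sup (range g) = g i.
Proof.
rewrite sup_range_bigmax; elim/big_ind: _ => [|x y [i ->] [j ->]|i _].
- by exists ord0.
- by case: (leP (g i) (g j)); [exists j|exists i].
- by exists i.
Qed.

Lemma sup_range_ub (R : realType) n (g : 'I_n.+1 -> R) i : g i <= sup (range g).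
Proof. by rewrite sup_range_bigmax; exact: le_bigmax. Qed.

(** * Measurability of truth values *)

Section measurability.
Variable R : realType.

Lemma measurable_I01val : measurable_fun setT (@I01val R).
Proof. by move=> _ B mB; rewrite setTI; exists B => //; rewrite setTI. Qed.

(** The default [h0] may depend on the point, because [sup_range_bigmax] starts the maximum at a
    value of the function itself. *)
Lemma measurable_fun_bigmax d (T : measurableType d) (I : Type) (s : seq I)
    (h0 : T -> R) (h : I -> T -> R) :
  measurable_fun setT h0 -> (forall i, measurable_fun setT (h i)) ->
  measurable_fun setT (fun x => \big[Num.max/h0 x]_(i <- s) h i x).
Proof.
move=> m0 mh; elim: s => [|i s IH].
  by under eq_fun do rewrite big_nil.
by under eq_fun do rewrite big_cons; exact: measurable_maxr.
Qed.

Lemma measurable_sup_range d (T : measurableType d) n (h : 'I_n.+1 -> T -> R) :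
  (forall i, measurable_fun setT (h i)) ->
  measurable_fun setT (fun x => sup (range (h^~ x))).
Proof.
move=> mh; under eq_fun do rewrite sup_range_bigmax.
exact: measurable_fun_bigmax.
Qed.

Lemma measurable_eval (tau : vocabulary) n k (f : formula tau k)
    (e : k.-tuple 'I_n.+1) :
  measurable_fun setT (fun M : structure R tau 'I_n.+1 => Defs.eval M f e).
Proof.
elim: f e => {k} [k Q v|k f IHf g IHg|k f IHf g IHg|k f IHf g IHg|k f IHf
                 |k f IHf|k f IHf] e /=.
(* An atom reads one coordinate of the structure, so the preimage of [B] is a cylinder. *)
- apply: (measurableT_comp measurable_I01val) => _ B mB; rewrite setTI.
  by apply: sub_sigma_algebra; exists Q, [tuple of map (tnth e) v], B.
- exact: measurable_minr.
- exact: measurable_maxr.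
- by apply: measurable_minr => //; apply: measurable_funD => //;
    exact: measurable_funB.
- exact: measurable_funB.
(* By definition [inf] is the opposite of the [sup] of the opposites, which reduces this case to a
   finite maximum. *)
- under eq_fun do rewrite /inf image_comp.
  apply: measurable_funN; apply: measurable_sup_range => i.
  exact: measurable_funN.
- exact: measurable_sup_range.
Qed.

End measurability.

(** * The existential sentence attached to a term *)

Section existential_closure.
Variable tau : vocabulary.

Fixpoint ex_closure k : formula tau k -> sentence tau :=
  match k with
  | 0 => fun f => f
  | k.+1 => fun f => ex_closure (FEx f)
  end.

Lemma value_ex_closure_ge (R : realType) n (M : structure R tau 'I_n.+1)
    k (f : formula tau k) (e : k.-tuple 'I_n.+1) :
  Defs.eval M f e <= value M (ex_closure f).
Proof.
elim: k f e => [|k IH] f e /=; first by rewrite (tuple0 e).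
(* [FEx] binds variable 0, so the head of [e] is its witness and the tail is left to the
   induction. *)
rewrite (tuple_eta e); apply: le_trans (IH (FEx f) [tuple of behead e]) => /=.
exact: (sup_range_ub (fun a => Defs.eval M f [tuple of a :: [tuple of behead e]])).
Qed.

(** Every quantifier is a maximum over a finite nonempty domain. For a diagonal formula, this makes
    the value of the sentence a value of the term, hence at most the supremum. *)
Lemma value_ex_closure_attained (R : realType) n (M : structure R tau 'I_n.+1)
    k (f : formula tau k) :
  exists e : k.-tuple 'I_n.+1, value M (ex_closure f) = Defs.eval M f e.
Proof.
elim: k f => [|k IH] f /=; first by exists [tuple].
have [e ->] := IH (FEx f).
have [a Ea] := sup_range_attained (fun a => Defs.eval M f [tuple of a :: e]).
by exists [tuple of a :: e].
Qed.

Fixpoint diag_formula (Q : tau) k (t : mv_term k) : formula tau k :=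
  match t with
  | TVar i => Atom (nseq_tuple (arity Q) i)
  | TAnd t u => FAnd (diag_formula Q t) (diag_formula Q u)
  | TOr t u => FOr (diag_formula Q t) (diag_formula Q u)
  | TImp t u => FImp (diag_formula Q t) (diag_formula Q u)
  | TNeg t => FNeg (diag_formula Q t)
  end.

Lemma eval_diag_formula (R : realType) (D : Type) (M : structure R tau D)
    (Q : tau) k (t : mv_term k) (e : k.-tuple D) :
  Defs.eval M (diag_formula Q t) e =
  mv_eval (fun i => M Q (nseq_tuple (arity Q) (tnth e i))) t.
Proof.
elim: t => /= [i|t -> u ->|t -> u ->|t -> u ->|t ->] //.
by congr (I01val (M Q _)); apply: val_inj; rewrite /= map_nseq.
Qed.

End existential_closure.

(** * Probability of missing a target set on the diagonal *)

Section random_structures.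
Variables (R : realType) (tau : vocabulary) (p : tau -> probability (I01 R) R).

Definition diag_avoids n (Q : tau) (J : set (I01 R)) :
    set (structure R tau 'I_n) :=
  [set M | forall x, ~ J (M Q (nseq_tuple (arity Q) x))].

Lemma measurable_diag_avoids n Q (J : set (I01 R)) :
  measurable J -> measurable (@diag_avoids n Q J).
Proof.
move=> mJ; have -> : @diag_avoids n Q J = \bigcap_(x in [set: 'I_n])
    [set M | (~` J) (M Q (nseq_tuple (arity Q) x))].
  by apply/seteqP; split=> M /= H x; [move=> _|]; exact: H.
apply: fin_bigcap_measurable => [|x _]; first exact: finite_finset.
apply: sub_sigma_algebra.
by exists Q, (nseq_tuple (arity Q) x), (~` J); split=> //; exact: measurableC.
Qed.

(* A positive arity makes the diagonal ground atoms Q(x, ..., x) pairwise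
   distinct, hence independent. *)
Lemma structure_prod_diag_avoids n Q (J : set (I01 R)) :
  (0 < arity Q)%N -> measurable J ->
  structure_prod n p (diag_avoids Q J) = (fine (p Q (~` J)) ^+ n)%:E.
Proof.
move=> Q_gt0 mJ; have mCJ := measurableC mJ.
pose g (x : 'I_n) : ground_atom tau n :=
  Tagged (fun Q => (arity Q).-tuple 'I_n) (nseq_tuple (arity Q) x).
(* Constraining only the diagonal atoms presents the event as a rectangle, to which
   [structure_prodE] applies. *)
pose A Q' (a : (arity Q').-tuple 'I_n) : set (I01 R) :=
  if (Tagged (fun Q => (arity Q).-tuple 'I_n) a) \in codom g then ~` J else setT.
have g_inj : injective g.
  move=> x y /eqP; rewrite eq_Tagged /= => /eqP/(congr1 val)/=.
  by case: (arity Q) Q_gt0 => [//|m] _ [].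
have -> : @diag_avoids n Q J = [set M | forall Q' a, A Q' a (M Q' a)].
  apply/seteqP; split=> M /= H.
    move=> Q' a; rewrite /A; case: ifP => // /codomP[x E].
    have := H x; rewrite /setC /=.
    (* Evaluating [M] on both sides of [E] avoids transporting the tuple [a] along an equality of
       symbols. *)
    by move: (f_equal (fun z : ground_atom tau n => M (tag z) (tagged z)) E) => /= ->.
  by move=> x; have := H Q (nseq_tuple (arity Q) x); rewrite /A (codom_f g x).
rewrite structure_prodE; last by move=> Q' a; rewrite /A; case: ifP.
rewrite (sig_big_dep _ _ (fun Q' a => p Q' (A Q' a))) /=.
(* Unconstrained atoms contribute the factor 1; injectivity of [g] leaves exactly [n] equal
   factors. *)
transitivity (\prod_(z in codom g) p Q (~` J))%E.
  rewrite [RHS]big_mkcond /=; apply: eq_bigr => -[Q' a] _ /=.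
  rewrite /A; case: ifPn => [/codomP[x E]|_]; last exact: probability_setT.
  by have -> : Q' = Q by exact: (congr1 (@tag _ _) E).
rewrite -[p Q _]fineK ?fin_num_measure// prodEFin prodr_const.
by rewrite card_codom// card_ord.
Qed.

Lemma cvg_sum_expr0 k (q : 'I_k -> R) :
  (forall i, 0 <= q i < 1) ->
  (\sum_(i < k) q i ^+ n.+1) @[n --> \oo] --> (0 : R).
Proof.
move=> q01; rewrite [X in _ --> X](_ : 0 = \sum_(i < k) 0); last first.
  by rewrite big1.
apply: cvg_big => [|i _]; first exact: add_continuous.
rewrite (cvg_shiftS (fun n => q i ^+ n)); apply: cvg_expr.
by have /andP[q0 q1] := q01 i; rewrite ger0_norm.
Qed.

(** Union bound: if [f] has its value outside [V], then some [J i] is avoided by the whole diagonal.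
    On a domain of size [n.+1] this has probability at most the sum of the [q i ^+ n.+1], where
    [q i < 1] because [J i] has positive measure. *)
Lemma mu_cvg1_of_diag_hits k Q (J : 'I_k -> set (I01 R))
    (V : set R) (f : sentence tau) :
  (0 < arity Q)%N -> (forall i, measurable (J i)) ->
  (forall i, (0 < p Q (J i))%E) -> measurable V ->
  (forall n (M : structure R tau 'I_n.+1),
    (forall i, ~ diag_avoids Q (J i) M) -> V (value M f)) ->
  mu n p f V @[n --> \oo] --> 1%E.
Proof.
move=> Q_gt0 mJ J_gt0 mV VJ.
pose q i := fine (p Q (~` J i)).
have q01 i : 0 <= q i < 1.
  rewrite /q fine_ge0 //= -lte_fin fineK ?fin_num_measure//; last exact: measurableC.
  by rewrite probability_setC// gte_subl// fin_num_measure.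
have mVf n : measurable [set M : structure R tau 'I_n.+1 | V (value M f)].
  by rewrite -[X in measurable X]setTI; exact: measurable_eval.
(* The shift discards the empty domain, where quantifiers are not maxima. *)
rewrite -cvg_shiftS.
have bounds n :
    ((1 - \sum_(i < k) q i ^+ n.+1)%:E <= mu n.+1 p f V <= 1)%E.
  rewrite /mu probability_le1// andbT.
  rewrite -[X in structure_prod _ _ X]setCK probability_setC; last exact: measurableC.
  rewrite EFinB leeB// -sumEFin.
  under eq_bigr do rewrite -structure_prod_diag_avoids//.
  (* Subadditivity is stated for sequences indexed by [nat], so the finite family is padded with
     [set0]. *)
  pose F (m : nat) : set (structure R tau 'I_n.+1) :=
    if insub m is Some i then diag_avoids Q (J i) else set0.
  have FE (i : 'I_k) : F i = diag_avoids Q (J i) by rewrite /F valK.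
  under eq_bigr do rewrite -FE.
  apply: content_subadditive.
  - move=> m _; rewrite /F; case: insubP => // i _ _.
    exact: measurable_diag_avoids.
  - exact: measurableC.
  - move=> M /= nV; apply: contrapT => H; apply: nV; apply: VJ => i Mi.
    by apply: H; rewrite -bigcup_mkord; exists i => //=; rewrite FE.
have lower_cvg :
    (1 - \sum_(i < k) q i ^+ n.+1)%:E @[n --> \oo] --> (1 : R)%:E.
  apply: cvg_EFin; first exact: nearW.
  rewrite -[X in _ --> X]subr0; apply: cvgB; first exact: cvg_cst.
  exact: cvg_sum_expr0.
exact: (squeeze_cvge (nearW _ bounds) lower_cvg (cvg_cst 1%E)).
Qed.

End random_structures.

(** * Almost sure values from suprema and by reflection *)

Section almost_sure_values.
Variables (R : realType) (tau : vocabulary) (p : tau -> probability (I01 R) R).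

Definition I01_ball (c : I01 R) (d : R) : set (I01 R) :=
  [set x | `|I01val x - I01val c| < d].

Lemma measurable_I01_ball c d : measurable (I01_ball c d).
Proof.
have -> : I01_ball c d = setT `&` @I01val R @^-1` ball (I01val c) d.
  rewrite setTI; apply/seteqP.
  by split=> x; rewrite /I01_ball /= -ball_normE /ball_ /= distrC.
apply: measurable_I01val => //; apply: open_measurable; exact: ball_open.
Qed.

Lemma I01_ball_gt0 (P : probability (I01 R) R) c d :
  charges_intervals P -> 0 < d -> (0 < P (I01_ball c d))%E.
Proof.
move=> P_pos d0; have c01 := I01val_itv c.
set r := I01val c in c01.
have -> : I01_ball c d =
    @I01val R @^-1` [set x | 0 <= x <= 1 /\ r - d < x < r + d].
  apply/seteqP; split=> x; rewrite /I01_ball /= ltr_distl => H //.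
    by split=> //; exact: I01val_itv.
  by case: H.
apply: P_pos.
- by move=> x [+ _] /=; rewrite in_itv.
- by move=> x y /= [x01 xd] [y01 yd] z xzy; split; lra.
(* Truncation to the unit interval keeps these two points distinct even when [r] is 0 or 1. *)
- exists (Num.max 0 (r - d / 2)), (Num.min 1 (r + d / 2)).
  by split=> /=; [split| split|];
    case: (leP 0 (r - d / 2)); case: (leP 1 (r + d / 2)) => ? ?; lra.
Qed.

Lemma almost_sure_value_sup Q k (t : mv_term k) :
  (0 < arity Q)%N -> charges_intervals (p Q) ->
  almost_sure_value p (mv_sup R t).
Proof.
move=> Q_gt0 pQ; exists (ex_closure (diag_formula Q t)) => V [iV [U oU VU]] Vs.
have [e /= e0 eU] : nbhs_ball (mv_sup R t) U.
  apply/nbhs_ballP; apply: open_nbhs_nbhs; split=> //.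
  by move: Vs; rewrite VU => -[].
have e20 : 0 < e / 2 by rewrite divr_gt0.
have [_ [a _ <-] sa] := sup_adherent e20 (has_sup_mv_eval R t).
have [C C0 lipC] := mv_eval_lipschitz R t.
(* Half of [e] bounds the gap between the value at [a] and the supremum; this [d] makes the
   Lipschitz error the other half. *)
pose d := e / 2 / C.
apply: (@mu_cvg1_of_diag_hits _ _ _ k Q (fun i => I01_ball (a i) d)) => //.
- by move=> i; exact: measurable_I01_ball.
- by move=> i; apply: I01_ball_gt0 => //; rewrite divr_gt0.
- exact: is_interval_measurable.
move=> n M hits.
have /choice[x Hx] (i : 'I_k) :
    exists x, I01_ball (a i) d (M Q (nseq_tuple (arity Q) x)).
  by apply: contrapT => H; apply: (hits i) => x Jx; apply: H; exists x.
(* The hitting points [x] bound the value from below, and a maximizing tuple [y] bounds it from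
   above. *)
have := value_ex_closure_ge M (diag_formula Q t) (mktuple x).
have [y ->] := value_ex_closure_attained M (diag_formula Q t).
rewrite !eval_diag_formula.
set b := fun i : 'I_k => M Q (nseq_tuple _ (tnth (mktuple x) i)).
set w := mv_eval (fun i => M Q (nseq_tuple _ (tnth y i))) t => bw.
have ws : w <= mv_sup R t by exact: mv_eval_le_sup.
have w01 : 0 <= w <= 1 by exact: mv_eval_itv.
have : `|mv_eval b t - mv_eval a t| <= C * d.
  by apply: lipC => i; rewrite /b tnth_mktuple; apply/ltW/Hx.
have -> : C * d = e / 2 by rewrite /d mulrC divfK// gt_eqF.
rewrite ler_norml => ba; rewrite VU; split; first by rewrite /= in_itv.
apply: eU; rewrite -ball_normE /ball_ /= ger0_norm ?subr_ge0//.
by move: sa; rewrite -/(mv_sup R t); lra.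
Qed.

Lemma open_interval01_onem (V : set R) :
  open_interval01 V -> open_interval01 [set x | V (1 - x)].
Proof.
move=> [iV [U oU VU]]; split.
  (* Reflection reverses the order, so the endpoints are swapped. *)
  by move=> x y /= Vx Vy z xzy; apply: (iV _ _ Vy Vx); lra.
exists ((fun x => 1 - x) @^-1` U).
  apply: open_comp oU => x _; apply: cvgB; [exact: cvg_cst|exact: cvg_id].
by apply/seteqP; split=> x /=; rewrite VU /= !in_itv /= => -[? ?]; split=> //; lra.
Qed.

(** The event that [FNeg f] lies in [V] is, by computation, the event that [f] lies in the
    reflection of [V], so both have the same measure. *)
Lemma almost_sure_value_onem (a : R) :
  almost_sure_value p a -> almost_sure_value p (1 - a).
Proof.
move=> [f fa]; exists (FNeg f) => V oV Va.
exact: (fa [set x | V (1 - x)] (open_interval01_onem oV) Va).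
Qed.

End almost_sure_values.

Theorem theorem6p1 (R : realType) (tau : vocabulary)
    (tau_pos : exists Q : tau, (0 < arity Q)%N)
    (p : tau -> probability (I01 R) R)
    (p_pos : forall Q : tau, charges_intervals (p Q))
    (k : nat) (t : mv_term k) :
  almost_sure_value p (mv_inf R t) /\
  almost_sure_value p (mv_sup R t).
Proof.
have [Q Q_gt0] := tau_pos.
split; last exact: almost_sure_value_sup (p_pos Q).
rewrite mv_inf_neg; apply: almost_sure_value_onem.
exact: almost_sure_value_sup (p_pos Q).
Qed.
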